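(* Let $1\le p<\infty$, let $(X,d)$ be a finite metric space, and let $\mu\in\mathcal{P}(X)$. Let $Y_1,Y_2,\ldots$ be i.i.d. $X$-valued random elements with common distribution $\mu$, and let $\bar\mu_n=\frac1n\sum_{i=1}^n\delta_{Y_i}$. (a) $F_p(\bar\mu_n)\to F_p(\mu)$ in the Fell topology $\tau_F$ almost surely if and only if $F_p(\mu)=[x]_\mu$ for some $x\in X$. (b) $F_p^\ast(\bar\mu_n)\to F_p^\ast(\mu)$ in the Fell topology $\tau_F$ almost surely if and only if $F_p^\ast(\mu)=[x]_\mu$ for some $x\in X$.
   Context: $\mathcal{P}(X)$ is the set of Borel probability measures on $X$. $F_p(\mu)=\arg\min_{x\in X}\int_X d^p(x,y)\,d\mu(y)$ and $F_p^\ast(\mu)=\arg\min_{x\in\mathrm{supp}(\mu)}\int_X d^p(x,y)\,d\mu(y)$, where $\mathrm{supp}(\mu)$ is the set of points all of whose open neighborhoods have positive $\mu$-measure. Equivalence relation: for $x,x'\in X$ write $x\leadsto_\mu x'$ if, for all sufficiently small $\varepsilon>0$, there exists a measurable map $\phi:B_\varepsilon(x)\to B_\varepsilon(x')$ between open balls such that for every $z\in B_\varepsilon(x)$, $d(\phi(z),\cdot)=d(z,\cdot)$ holds $\mu$-almost everywhere. Write $x\sim_\mu x'$ if $x\leadsto_\mu x'$ and $x'\leadsto_\mu x$; this is an equivalence relation with classes $[x]_\mu$. (For discrete $X$, $x\sim_\mu x'$ iff $d(x,\cdot)=d(x',\cdot)$ $\mu$-almost everywhere.) Convergence $C_n\to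 C$ in the Fell topology (on closed subsets of the locally compact space $X$) is equivalent to Kuratowski convergence $\mathrm{Li}_{n\to\infty}C_n=\mathrm{Ls}_{n\to\infty}C_n=C$, where $\mathrm{Ls}_{n\to\infty} C_n$ (respectively $\mathrm{Li}_{n\to\infty} C_n$) is the set of $x$ such that every open neighborhood of $x$ meets $C_n$ for infinitely many $n$ (respectively for all sufficiently large $n$). *)

(* Defs.v *)
From HB Require Import structures.
From mathcomp Require Import all_boot all_order all_algebra finmap.
From mathcomp Require Import all_classical all_reals all_analysis.

Set Implicit Arguments.
Unset Strict Implicit.
Unset Printing Implicit Defensive.

Import Order.TTheory GRing.Theory Num.Theory.
Import numFieldNormedType.Exports.

Local Open Scope classical_set_scope.
Local Open Scope ring_scope.

(* Measurable types of MathComp-Analysis are pointed, hence the base point.  A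
   space that carries a probability measure is nonempty, so nothing is lost. *)
#[short(type="pointedMetricType")]
HB.structure Definition PointedMetric (K : numDomainType) :=
  {M of Pointed M & Metric K M}.

Definition borel (R : realType) (X : pointedMetricType R) :=
  g_sigma_algebraType (@open X).

HB.instance Definition _ (R : realType) (X : pointedMetricType R) :=
  Measurable.on (borel X).

(* The Fell topology, generated by the sets {C | C misses K}, K compact, and
   {C | C hits U}, U open.  It is put on all subsets of X; its trace on the
   closed subsets is the usual hyperspace topology.  In a finite metric space
   every subset is closed. *)
Definition fell (X : topologicalType) := set X.

Definition fell_miss (X : topologicalType) (K : set X) : set (fell X) :=
  [set C : set X | C `&` K = set0].

Definition fell_hit (X : topologicalType) (U : set X) : set (fell X) :=
  [set C : set X | C `&` U !=set0].

Definition fell_subbase (X : topologicalType) : set (set (fell X)) :=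
  [set @fell_miss X K | K in compact] `|` [set @fell_hit X U | U in open].

HB.instance Definition _ (X : topologicalType) := Choice.on (fell X).
HB.instance Definition _ (X : topologicalType) :=
  isSubBaseTopological.Build (fell X) (@fell_subbase X) id.

Definition fell_cvg (X : topologicalType) (C : nat -> set X) (C0 : set X) :=
  (fun n => C n : fell X) @ \oo --> (C0 : fell X).

Section frechet_means.
Context (R : realType) (X : pointedMetricType R).
Implicit Type mu : {measure set (borel X) -> \bar R}.

Definition argmin (D : set X) (f : X -> \bar R) : set X :=
  [set x | D x /\ forall x', D x' -> (f x <= f x')%E].

Definition frechet_functional (p : R) mu (x : X) : \bar R :=
  (\int[mu]_(y in [set: borel X]) ((mdist x (y : X)) `^ p)%:E)%E.

Definition supp mu : set X :=
  [set x | forall U : set X, open U -> U x -> (0 < mu U)%E].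

Definition frechet_mean (p : R) mu : set X :=
  argmin [set: X] (frechet_functional p mu).

Definition restricted_frechet_mean (p : R) mu : set X :=
  argmin (supp mu) (frechet_functional p mu).

(* A map between the balls is the restriction of a total phi; measurable_fun on
   the ball refers to the trace of the Borel sigma-algebra. *)
Definition leadsto mu (x x' : X) : Prop :=
  \forall e \near (0 : R)^'+, exists phi : borel X -> borel X,
    [/\ measurable_fun (ball x e : set (borel X)) phi,
        (forall z : X, ball x e z -> ball x' e (phi z : X)) &
        forall z : X, ball x e z ->
          {ae mu, forall y : borel X,
             mdist (phi z : X) (y : X) = mdist z (y : X)}].

Definition mu_equiv mu (x x' : X) : Prop := leadsto mu x x' /\ leadsto mu x' x.

Definition mu_class mu (x : X) : set X := [set x' | mu_equiv mu x x'].

(* For n = 0 this is the zero measure. *)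
Definition empirical_measure (y : nat -> X) (n : nat) :
    {measure set (borel X) -> \bar R} :=
  mscale (n%:R^-1)%:nng (msum (fun i => dirac (y i : borel X)) n).

End frechet_means.

Definition mutually_independent (R : realType) (d d' : measure_display)
    (Omega : measurableType d) (T : measurableType d') (P : probability Omega R)
    (Y : nat -> {RV P >-> T}) : Prop :=
  forall (J : {fset nat}) (A : nat -> set T),
    (forall i, i \in J -> measurable (A i)) ->
    P (\bigcap_(i in [set` J]) (Y i @^-1` A i)) =
    (\prod_(i <- J) P (Y i @^-1` A i))%E.

Definition identically_distributed (R : realType) (d d' : measure_display)
    (Omega : measurableType d) (T : measurableType d') (P : probability Omega R)
    (mu : probability T R) (Y : nat -> {RV P >-> T}) : Prop :=
  forall (i : nat) (A : set T),
    measurable A -> distribution P (Y i) A = mu A.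

(* Main.v *)
(** For x and x' in the limiting set of means, convergence forces the sums of
    d^p(x, Y_i) and d^p(x', Y_i) over i < n to agree for all large n, hence
    d(x, Y_n) = d(x', Y_n) for all large n.  Almost surely every atom of mu is
    visited infinitely often, so x and x' are at equal distance from every atom,
    that is, equivalent.  Conversely, almost surely only atoms are visited, so
    equivalent points have the same empirical functional, while the strict
    inequalities between values of the population functional eventually hold
    empirically.  The only limit theorem needed is one-sided: if g has negative
    mean, then almost surely the sums of g(Y_i) are eventually negative.  It
    follows from Chernoff's bound and the first Borel-Cantelli lemma. *)
Require Import Defs.
From mathcomp Require Import all_boot all_order all_algebra finmap.
From mathcomp Require Import all_classical all_reals all_analysis.
From mathcomp Require Import measurable_realfun ring lra.

Set Implicit Arguments.
Unset Strict Implicit.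
Unset Printing Implicit Defensive.

Import Order.TTheory GRing.Theory Num.Theory.
Import numFieldNormedType.Exports.

Local Open Scope classical_set_scope.
Local Open Scope ring_scope.

(** * Topology, support and equivalence in a finite metric space *)

Lemma finite_metric_open (R : realType) (X : pointedMetricType R)
    (hX : finite_set [set: X]) (A : set X) : open A.
Proof.
rewrite -(setCK A); apply: closed_openC.
have acc : accessible_space X.
  exact/hausdorff_accessible/(@metric_hausdorff R X).
apply: (accessible_finite_set_closed.1 acc).
exact: sub_finite_set hX.
Qed.

Lemma finite_metric_measurable (R : realType) (X : pointedMetricType R)
    (hX : finite_set [set: X]) (A : set (borel X)) : measurable A.
Proof. by apply: sub_sigma_algebra; exact: (finite_metric_open hX). Qed.

(** Finite intersections stay in a filter. Serves [\oo], right neighbourhoods of 0 and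
    almost-everywhere filters alike, to pass from each point to all points at once. *)
Lemma finite_near (T : choiceType) (hT : finite_set [set: T]) (I : Type)
    (F : set_system I) (FF : Filter F) (Q : T -> I -> Prop) :
  (forall x, \forall i \near F, Q x i) -> \forall i \near F, forall x, Q x i.
Proof.
move=> FQ; have xT (x : T) : x \in fset_set [set: T].
  by rewrite in_fset_set// in_setT.
have := @filter_forall I (fset_set [set: T]) (fun y => Q (val y)) F FF
  (fun y => FQ (val y)).
by apply: filterS => i Qi x; exact: (Qi [` xT x]%fset).
Qed.

(** Singletons are open and compact, so hitting and missing [[set x]] decide membership of [x]; with
    finitely many [x] the Fell topology is discrete. *)
Lemma fell_cvgP (R : realType) (X : pointedMetricType R)
    (hX : finite_set [set: X]) (C : nat -> set X) (C0 : set X) :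
  fell_cvg C C0 <-> \forall n \near \oo, C n = C0.
Proof.
split=> [CC0|CC0]; last first.
  apply: cvg_near_cst; exact: CC0.
have sub_open (A : set (fell X)) : fell_subbase A -> open A.
  move=> bA.
  (* [A] is a union of one set, itself an intersection of one subbasic set. *)
  exists [set A]; last by rewrite bigcup_set1.
  move=> _ ->; exists [fset A]%fset; first by move=> B /fset1P -> /=; rewrite inE.
  by rewrite set_fset1 bigcap_set1.
have near_sub (A : set (fell X)) : fell_subbase A -> A C0 ->
    \forall n \near \oo, A (C n).
  by move=> bA AC0; apply: CC0; exact: open_nbhs_nbhs (conj (sub_open _ bA) AC0).
have : \forall n \near \oo, forall x, C n x <-> C0 x.
  apply: (finite_near hX) => x; have [xC0|xC0] := pselect (C0 x).
    have : \forall n \near \oo, fell_hit [set x] (C n).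
      apply: near_sub; last by exists x.
      by right; exists [set x] => //; exact: finite_metric_open.
    by apply: filterS => n [y [Cny xy]]; split=> // _; rewrite -xy.
  have : \forall n \near \oo, fell_miss [set x] (C n).
    apply: near_sub; first by left; exists [set x] => //; exact: compact_set1.
    by apply/seteqP; split=> // y [C0y yx]; apply: xC0; rewrite -yx.
  apply: filterS => n Cn; split=> // Cnx.
  by have : (C n `&` [set x]) x by []; rewrite Cn.
by apply: filterS => n Cn; apply/seteqP; split=> x /Cn.
Qed.

Lemma suppE (R : realType) (X : pointedMetricType R)
    (hX : finite_set [set: X]) (mu : {measure set (borel X) -> \bar R}) :
  supp mu = [set x | (0 < mu [set x])%E].
Proof.
apply/seteqP; split=> x /=; first by apply => //; exact: finite_metric_open.
move=> mx U _ Ux; apply: lt_le_trans mx _.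
apply: le_measure; rewrite ?inE; [exact: finite_metric_measurable..|].
by move=> y ->.
Qed.

Lemma finite_metric_ball (R : realType) (X : pointedMetricType R)
    (hX : finite_set [set: X]) (x : X) :
  \forall e \near (0 : R)^'+, ball x e = [set x].
Proof.
have : \forall e \near (0 : R)^'+, forall y, x <> y -> ~ ball x e y.
  apply: (finite_near hX) => y; have [->|/eqP xy] := pselect (x = y).
    by apply: nearW.
  have : 0 < mdist x y by rewrite mdist_gt0.
  move=> /nbhs_right_lt; apply: filterS => e exy _.
  by rewrite ballEmdist /= => /(lt_trans exy); rewrite ltxx.
move=> Hx; near=> e; apply/seteqP; split=> [y bxy|y ->].
  have Bx : forall y, x <> y -> ~ ball x e y by near: e.
  by apply: contrapT => yx; apply: Bx bxy => xy; apply: yx.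
by rewrite ballEmdist /= mdistxx; near: e; exact: nbhs_right_gt.
Unshelve. all: by end_near. Qed.

(** For small radii both balls are singletons, so [phi] can only send one centre to the other; and a
    measurable set is null exactly when it misses the support. *)
Lemma mu_equivP (R : realType) (X : pointedMetricType R)
    (hX : finite_set [set: X]) (mu : {measure set (borel X) -> \bar R})
    (x x' : X) :
  mu_equiv mu x x' <-> forall y, supp mu y -> mdist x y = mdist x' y.
Proof.
have aeP (a b : X) :
    {ae mu, forall y : borel X, mdist a (y : X) = mdist b (y : X)} <->
    forall y, supp mu y -> mdist a y = mdist b y.
  rewrite suppE//; split=> [[N [mN N0 sN]] y /= my|Hab].
    apply: contrapT => aby; have : (mu [set y] <= mu N)%E.
      apply: le_measure; rewrite ?inE//; first exact: finite_metric_measurable.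
      by move=> _ ->; exact: sN.
    by rewrite N0 leNgt my.
  have aeF : Filter (almost_everywhere mu) by exact: ae_filter_ringOfSetsType.
  (* Naming the value [z] of [y] leaves one claim per singleton: either the distances agree at [z],
     or [[set z]] is null. *)
  have : \forall y \ae mu, forall z : X, y = z -> mdist a (y : X) = mdist b (y : X).
    apply: (finite_near hX) => z; have [zab|zab] := pselect (mdist a z = mdist b z).
      by apply: aeW => _ ->.
    exists [set z]; split; first exact: finite_metric_measurable.
      apply/eqP; rewrite eq_le measure_ge0 andbT leNgt; apply/negP.
      by move=> /Hab.
    by move=> y /= /not_implyP[].
  by apply: filterS => y; apply.
have leadstoP (a b : X) : leadsto mu a b <->
    {ae mu, forall y : borel X, mdist b (y : X) = mdist a (y : X)}.
  have Fp : ProperFilter ((0 : R)^'+) by exact: at_right_proper_filter.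
  have ballab : \forall e \near (0 : R)^'+, ball a e = [set a] /\ ball b e = [set b].
    exact: filterI (finite_metric_ball hX a) (finite_metric_ball hX b).
  split=> [/(filterI ballab)|Hab].
    move=> /filter_ex[e [[Ba Bb] [phi [_]]]]; rewrite Ba Bb => phiE /(_ a erefl).
    by rewrite (phiE a erefl).
  have := finite_metric_ball hX a; apply: filterS2 (finite_metric_ball hX b).
  move=> e Bb Ba; exists (fun=> b); split; first exact: measurable_cst.
    by rewrite Bb.
  by rewrite Ba => z ->.
rewrite /mu_equiv !leadstoP !aeP; split=> [[? ?] //|H].
by split=> // y /H.
Qed.

(** * Frechet functionals as finite sums *)

Lemma finite_metric_measurable_fun (R : realType) (X : pointedMetricType R)
    (hX : finite_set [set: X]) (d : measure_display) (T : measurableType d)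
    (D : set (borel X)) (f : borel X -> T) :
  measurable_fun D f.
Proof. by move=> _ B _; exact: finite_metric_measurable. Qed.

(** The sum runs over the finite type attached to [[set: X]], the form in which [chernoff_bound]
    takes its weights. *)
Lemma frechet_functionalE (R : realType) (X : pointedMetricType R)
    (hX : finite_set [set: X]) (p : R) (mu : probability (borel X) R) (x : X) :
  frechet_functional p mu x =
  (\sum_(y : fset_set [set: X]) fine (mu [set val y]) * mdist x (val y) `^ p)%:E.
Proof.
set s := fset_set [set: X].
have mfX (f : borel X -> \bar R) : measurable_fun setT f :=
  finite_metric_measurable_fun hX f.
have mX (A : set (borel X)) : measurable A by exact: finite_metric_measurable.
have fE (y : borel X) : (mdist x (y : X) `^ p)%:E =
    (\sum_(z <- s) (mdist x z `^ p)%:E * (\1_[set z : borel X] y)%:E)%E.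
  have ys : (y : X) \in s by rewrite in_fset_set// in_setT.
  rewrite (big_fsetD1 (y : X))//= indicE in_set1 eqxx mule1 big1_fset ?adde0//.
  move=> z; rewrite !inE => /andP[zy _] _.
  by rewrite indicE in_set1 eq_sym (negbTE zy) mule0.
rewrite /frechet_functional; under eq_integral do rewrite fE.
rewrite ge0_integral_sum//; last first.
  by move=> z y _; rewrite -EFinM lee_fin mulr_ge0// powR_ge0.
rewrite -(big_seq_fsetE +%R s xpredT
  (fun y => fine (mu [set y]) * mdist x y `^ p)) /=.
rewrite -sumEFin; apply: eq_bigr => z _.
rewrite ge0_integralZl//; last by rewrite lee_fin powR_ge0.
rewrite integral_indic// setIT EFinM fineK ?fin_num_measure//.
by rewrite muleC.
Qed.

Lemma frechet_functional_empirical (R : realType) (X : pointedMetricType R)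
    (hX : finite_set [set: X]) (p : R) (y : nat -> X) (n : nat) (x : X) :
  frechet_functional p (empirical_measure y n) x =
  (n%:R^-1 * \sum_(i < n) mdist x (y i) `^ p)%:E.
Proof.
rewrite /frechet_functional /empirical_measure.
have mfX (f : borel X -> \bar R) : measurable_fun setT f :=
  finite_metric_measurable_fun hX f.
have f0 (z : borel X) : [set: borel X] z -> (0 <= (mdist x (z : X) `^ p)%:E)%E.
  by rewrite lee_fin powR_ge0.
rewrite ge0_integral_mscale//.
rewrite ge0_integral_measure_sum//.
rewrite EFinM -sumEFin; congr (_ * _)%E; apply: eq_bigr => i _.
rewrite integral_dirac//.
by rewrite diracE in_setT mul1e.
Qed.

Lemma supp_empirical (R : realType) (X : pointedMetricType R)
    (hX : finite_set [set: X]) (y : nat -> X) (n : nat) :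
  supp (empirical_measure (R := R) y n) =
  [set x | exists2 i, (i < n)%N & y i = x].
Proof.
have muE A : empirical_measure (R := R) y n A =
    ((n%:R^-1)%:E * \sum_(i < n) \d_(y i : borel X) A)%E by [].
rewrite suppE//; apply/seteqP; split=> x /=; rewrite muE.
  move=> H; apply: contrapT => nx; move: H.
  rewrite big1 ?mule0 ?ltxx// => i _.
  by rewrite diracE memNset//= => yx; apply: nx; exists i.
move=> [i lin <-]; apply: mule_gt0.
  by rewrite lte_fin invr_gt0 ltr0n (leq_ltn_trans _ lin).
rewrite (bigD1 (Ordinal lin))//=; apply: (@lt_le_trans _ _ 1%E) => //.
by rewrite diracE mem_set//= leeDl// sume_ge0.
Qed.

(** * Exponential tail bound and one-sided limit theorem *)

(** Markov's inequality for [expR (t * \sum_i g (f i))], where words [f] of length [n] carry product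
    weights; [r] bounds the exponential moment of one letter. *)
Lemma chernoff_bound (R : realType) (T : finType) (m g : T -> R)
    (m0 : forall y, 0 <= m y) (m1 : \sum_y m y = 1) :
  \sum_y m y * g y < 0 ->
  exists2 r : R, 0 < r < 1 & forall n,
    \sum_(f : {ffun 'I_n -> T} | 0 <= \sum_i g (f i)) \prod_i m (f i) <= r ^+ n.
Proof.
set e := \sum_y m y * g y => e0.
pose B := 1 + \sum_y `|g y|.
have gB y : `|g y| <= B.
  rewrite /B (bigD1 y)//= addrCA lerDl addr_ge0// sumr_ge0//.
have B1 : 1 <= B by rewrite lerDl sumr_ge0.
have B0 : 0 < B by rewrite (lt_le_trans _ B1).
have eB : - e <= B.
  rewrite -sumrN -(mul1r B) -m1 mulr_suml; apply: ler_sum => y _.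
  rewrite -mulrN ler_wpM2l// (le_trans _ (gB y))// -normrN ler_norm//.
(* [t] minimizes [t * e + 2 * t ^+ 2 * B ^+ 2]. *)
pose t := - e / (4 * B ^+ 2).
have t0 : 0 < t by rewrite divr_gt0// ?oppr_gt0// mulr_gt0// exprn_gt0.
have tB : t * B <= 4^-1.
  rewrite /t -mulrA invfM expr2 invfM -!mulrA mulVf ?gt_eqF// mulr1 mulrC -mulrA.
  by rewrite ler_piMr// mulrC ler_pdivrMr// mul1r.
have tg y : `|t * g y| <= 4^-1.
  by rewrite normrM gtr0_norm// (le_trans _ tB)// ler_wpM2l// ltW.
(* from [expR u <= 1 / (1 - u)] *)
have exp_le (u : R) : `|u| <= 4^-1 -> expR u <= 1 + u + 2 * u ^+ 2.
  move=> u4.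
  have eu : expR u * (1 - u) <= 1.
    have := expR_ge1Dx (- u); rewrite -(ler_pM2l (expR_gt0 u)) expRN.
    by rewrite divff// gt_eqF// expR_gt0.
  move: u4; rewrite ler_norml => /andP[u1 u2].
  have u3 : 0 < 1 - u by lra.
  (* The right-hand side times [1 - u] is [1 + u ^+ 2 * (1 - 2 * u)], hence at least 1. *)
  rewrite -(ler_pM2r u3) (le_trans eu)//; nra.
(* At this [t] the quadratic term equals [- (t * e / 2)] and cancels half of the linear one. *)
pose r := 1 + t * e / 2.
have phi_le : \sum_y m y * expR (t * g y) <= r.
  have : \sum_y m y * expR (t * g y) <=
      \sum_y (m y + t * (m y * g y) + m y * (2 * (t * B) ^+ 2)).
    apply: ler_sum => y _.
    rewrite mulrCA -{2}(mulr1 (m y)) -!mulrDr ler_wpM2l//.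
    rewrite (le_trans (exp_le _ (tg y)))//.
    rewrite lerD2l ler_wpM2l// -(real_normK (num_real (t * g y))) lerXn2r ?nnegrE//.
      by rewrite mulr_ge0// ltW.
    by rewrite normrM gtr0_norm// ler_wpM2l// ltW.
  move/le_trans; apply; rewrite !big_split/= m1 -mulr_sumr -mulr_suml m1 -/e mul1r /r.
  rewrite -addrA lerD2l.
  suff -> : 2 * (t * B) ^+ 2 = - (t * e / 2) by lra.
  rewrite /t; field; by rewrite gt_eqF.
(* Keeps [r] positive. *)
have te : - 4^-1 <= t * e.
  by rewrite -(opprK e) mulrN lerN2 (le_trans _ tB)// ler_wpM2l// ltW.
have te0 : t * e < 0 by rewrite pmulr_rlt0.
exists r; first by rewrite /r; apply/andP; split; lra.
move=> n; apply: (@le_trans _ _ ((\sum_y m y * expR (t * g y)) ^+ n)); last first.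
  rewrite lerXn2r ?nnegrE//; last by rewrite /r; lra.
  by apply: sumr_ge0 => y _; rewrite mulr_ge0// expR_ge0.
(* The power expands into a sum over all words. Words with negative total are dropped; on the others
   the exponential is at least 1. *)
rewrite -[X in _ ^+ X](card_ord n) -prodr_const bigA_distr_bigA/=.
rewrite [leRHS](bigID (fun f : {ffun 'I_n -> T} => 0 <= \sum_i g (f i)))/=.
have prod0 (f : {ffun 'I_n -> T}) : 0 <= \prod_i m (f i) by apply: prodr_ge0.
rewrite -[leLHS]addr0 lerD//; last first.
  by apply: sumr_ge0 => f _; apply: prodr_ge0 => i _; rewrite mulr_ge0// expR_ge0.
apply: ler_sum => f f0; rewrite big_split/= ler_peMr// -expR_sum -mulr_sumr.
by rewrite -expR0 ler_expR mulr_ge0// ltW.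
Qed.

Lemma mutually_independent_prefix (R : realType) (d d' : measure_display)
    (Omega : measurableType d) (T : measurableType d') (P : probability Omega R)
    (Y : nat -> {RV P >-> T}) (hind : mutually_independent Y)
    (n : nat) (A : 'I_n -> set T) (mA : forall i, measurable (A i)) :
  P (\bigcap_(i : 'I_n) (Y i @^-1` A i)) = (\prod_(i < n) P (Y i @^-1` A i))%E.
Proof.
(* [setT] is a default for [k >= n], never met on [J]. *)
pose B (k : nat) := if insub k is Some i then A i else setT.
have BE (i : 'I_n) : B i = A i by rewrite /B valK.
pose J := [fset k | k in iota 0 n]%fset.
have JE k : (k \in J) = (k < n)%N by rewrite !inE /= mem_iota.
have mB k : k \in J -> measurable (B k).
  by rewrite JE => kn; rewrite -[k]/(val (Ordinal kn)) BE.
have -> : \bigcap_(i : 'I_n) (Y i @^-1` A i) =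
    \bigcap_(k in [set` J]) (Y k @^-1` B k).
  apply/seteqP; split=> w H k /=.
    by rewrite JE => kn; have := H (Ordinal kn) I; rewrite -BE.
  by move=> _; rewrite -BE; apply: H; rewrite /= JE.
rewrite hind//; under [RHS]eq_bigr do rewrite -BE.
rewrite -(big_mkord xpredT (fun k => P (Y k @^-1` B k))) /index_iota subn0.
apply: perm_big; apply: uniq_perm; [exact: fset_uniq|exact: iota_uniq|].
by move=> k; rewrite JE mem_iota.
Qed.

Lemma sum_atoms (R : realType) (X : pointedMetricType R)
    (hX : finite_set [set: X]) (mu : probability (borel X) R) :
  \sum_(y : fset_set [set: X]) fine (mu [set val y]) = 1.
Proof.
have mX (A : set (borel X)) : measurable A by exact: finite_metric_measurable.
rewrite -(big_seq_fsetE +%R (fset_set [set: X]) xpredT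
  (fun y => fine (mu [set y]))) /=.
apply: EFin_inj; rewrite -sumEFin.
transitivity (\sum_(y <- fset_set [set: X]) mu [set y])%E.
  by apply: eq_bigr => y _; rewrite fineK// fin_num_measure.
rewrite -fsbig_finite// -(probability_setT mu).
transitivity (mu (\bigcup_(y in [set: X]) [set (y : borel X)])).
  by rewrite measure_fin_bigcup// => i j _ _ [z [/= <- <-]].
by congr (mu _); apply/seteqP; split=> // y _; exists y.
Qed.

(** A nonnegative sum at time [n] is a finite union of cylinders, whose probabilities are products
    of atom masses; [chernoff_bound] makes its probability at most [r ^+ n], which is summable. *)
Lemma ae_sum_lt0 (R : realType) (X : pointedMetricType R)
    (hX : finite_set [set: X]) (mu : probability (borel X) R)
    (d : measure_display) (Omega : measurableType d) (P : probability Omega R)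
    (Y : nat -> {RV P >-> borel X})
    (hind : mutually_independent Y) (hdist : identically_distributed mu Y)
    (g : X -> R) :
  \sum_(y : fset_set [set: X]) fine (mu [set val y]) * g (val y) < 0 ->
  {ae P, forall w, \forall n \near \oo, \sum_(i < n) g (Y i w) < 0}.
Proof.
set F := fset_set [set: X] => Eg.
have tX (x : X) : x \in F by rewrite in_fset_set// in_setT.
have mX (A : set (borel X)) : measurable A by exact: finite_metric_measurable.
have m0 (y : F) : 0 <= fine (mu [set val y]) by rewrite fine_ge0.
have [r /andP[r0 r1] Hr] :=
  @chernoff_bound R F _ (g \o val) m0 (sum_atoms hX mu) Eg.
pose cyl n (f : {ffun 'I_n -> F}) := \bigcap_(i : 'I_n) (Y i @^-1` [set val (f i)]).
have mcyl n f : measurable (@cyl n f).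
  apply: fin_bigcap_measurable => // i _.
  by rewrite -[_ @^-1` _]setTI; exact: measurable_funP.
have Pcyl n f : P (@cyl n f) = (\prod_i fine (mu [set val (f i)]))%:E.
  rewrite mutually_independent_prefix// -prodEFin; apply: eq_bigr => i _.
  rewrite fineK ?fin_num_measure//; exact: hdist.
pose E n := [set w | 0 <= \sum_(i < n) g (Y i w)].
pose D n (f : {ffun 'I_n -> F}) := 0 <= \sum_i g (val (f i)).
(* Words with negative total give [set0], so the union can run over the whole finite type. *)
pose C n f := if D n f then cyl n f else set0.
have mC n f : measurable (C n f) by rewrite /C; case: ifP.
have EE n : E n = \bigcup_(f : {ffun 'I_n -> F}) C n f.
  apply/seteqP; split=> w.
    pose f := [ffun i : 'I_n => [` tX (Y i w)]%fset].
    move=> Ew; exists f => //; rewrite /C ifT; first by move=> i _ /=; rewrite ffunE.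
    by rewrite /D; under eq_bigr do rewrite ffunE.
  move=> [f _]; rewrite /C; case: ifP => // Df wf; rewrite /E /=.
  have -> : \sum_(i < n) g (Y i w) = \sum_i g (val (f i)); last by [].
  by apply: eq_bigr => i _; rewrite (wf i I).
have mE n : measurable (E n) by rewrite EE; apply: fin_bigcup_measurable.
have PE n : (P (E n) <= (r ^+ n)%:E)%E.
  have /le_trans : (P (E n) <= \sum_(f \in [set: {ffun 'I_n -> F}]) P (C n f))%E.
    by apply: content_sub_fsum => //; [exact: finite_finset|rewrite EE].
  apply; have -> : [set: {ffun 'I_n -> F}] = [set` index_enum {ffun 'I_n -> F}].
    by apply/seteqP; split=> // f _; rewrite /= mem_index_enum.
  rewrite -fsbig_seq ?index_enum_uniq//.
  apply: (@le_trans _ _ (\sum_(f : {ffun 'I_n -> F} | D n f)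
      \prod_i fine (mu [set val (f i)]))%:E); last by rewrite lee_fin; exact: (Hr n).
  rewrite -sumEFin [leRHS]big_mkcond; apply: lee_sum => f _.
  by rewrite /C /D /=; case: ifP => _; rewrite ?measure0// Pcyl.
(* First Borel-Cantelli lemma: the limit superior of the bad events is null. *)
exists (lim_sup_set E); split.
- by apply: bigcap_measurable => // k _; exact: bigcup_measurable.
- apply: lim_sup_set_cvg0 => //.
  apply: (@le_lt_trans _ _ (1 / (1 - r))%:E); last exact: ltry.
  apply: lime_le; first exact: is_cvg_nneseries.
  apply: nearW => n; apply: (@le_trans _ _ (series (geometric 1 r) n)%:E).
    rewrite /series /= -sumEFin; apply: lee_sum => i _.
    by rewrite mul1r.
  by rewrite lee_fin geometric_le_lim// gtr0_norm.
- move=> w /= Hw n _; apply: contrapT => Hn; apply: Hw.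
  exists n => // k /= nk; rewrite ltNge; apply/negP => Ek; apply: Hn.
  by exists k.
Qed.

(** * Deterministic comparison of argmin sets *)

Lemma argmin_eq (R : realType) (X : pointedMetricType R) (D : set X)
    (f : X -> \bar R) (x x' : X) :
  argmin D f x -> argmin D f x' -> f x = f x'.
Proof.
by move=> [Dx fx] [Dx' fx']; apply/eqP; rewrite eq_le fx//= fx'.
Qed.

Lemma argmin_nonempty (R : realType) (X : pointedMetricType R)
    (hX : finite_set [set: X]) (D : set X) (f : X -> \bar R) :
  D !=set0 -> argmin D f !=set0.
Proof.
move=> [x0 Dx0].
have tX (x : X) : x \in fset_set [set: X] by rewrite in_fset_set// in_setT.
have P0 : val [` tX x0]%fset \in D by rewrite inE.
case: (@arg_minP _ _ _ [` tX x0]%fset (fun y => val y \in D) (f \o val) P0) => y.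
rewrite inE => Dy fy; exists (val y); split=> // z Dz.
by have := fy [` tX z]%fset; apply; rewrite /= inE.
Qed.

Lemma frechet_functional_equiv (R : realType) (X : pointedMetricType R)
    (hX : finite_set [set: X]) (p : R) (mu : probability (borel X) R) (x x' : X) :
  mu_equiv mu x x' -> frechet_functional p mu x = frechet_functional p mu x'.
Proof.
move=> /(mu_equivP hX); rewrite suppE//= => xx'.
rewrite !frechet_functionalE//; congr EFin; apply: eq_bigr => y _.
have [/xx' ->//|] := ltP 0%E (mu [set val y]).
by rewrite measure_le0 => /eqP ->; rewrite !mul0r.
Qed.

(** The deterministic core shared by both kinds of means, along one sequence [y] with the almost
    sure properties: [D] will be the whole space or [supp mu], and [Dn] its empirical
    counterpart. *)
Lemma argmin_eventually_class (R : realType) (p : R) (hp : 1 <= p)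
    (X : pointedMetricType R) (hX : finite_set [set: X])
    (mu : probability (borel X) R) (y : nat -> X)
    (D : set X) (Dn : nat -> set X) :
  let f := frechet_functional p mu in
  let fn n := frechet_functional p (empirical_measure y n) in
  (forall i, supp mu (y i)) ->
  (forall z, supp mu z -> forall N, exists2 n, (N <= n)%N & y n = z) ->
  (forall x x', (f x < f x')%E -> \forall n \near \oo, (fn n x < fn n x')%E) ->
  (\forall n \near \oo, Dn n = D) -> D !=set0 ->
  (forall x x', D x -> mu_equiv mu x x' -> D x') ->
  (\forall n \near \oo, argmin (Dn n) (fn n) = argmin D f) <->
  exists x, argmin D f = mu_class mu x.
Proof.
move=> f fn y_supp y_io f_lt DnD D0 D_equiv; split=> [[N _ argminN]|[x argminE]].
  have [x xmin] := argmin_nonempty hX f D0; exists x.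
  apply/seteqP; split=> [x' x'min|x' xx'].
    apply/(mu_equivP hX) => z /y_io /(_ N.+1) [n Nn <-].
    (* Strictness makes [k] nonzero, so the factor [k%:R^-1] cancels. *)
    have S_eq k : (N < k)%N ->
        \sum_(i < k) mdist x (y i) `^ p = \sum_(i < k) mdist x' (y i) `^ p.
      move=> Nk; move: xmin x'min; rewrite -(argminN k (ltnW Nk)) => xmin x'min.
      have := argmin_eq xmin x'min; rewrite /fn !frechet_functional_empirical//.
      move=> [] /mulfI; apply.
      by rewrite invr_eq0 pnatr_eq0 -lt0n (leq_ltn_trans _ Nk).
    (* The sums up to [n] and [n.+1] differ by the terms at [y n = z]; the power is injective
       because [p > 0]. *)
    have := S_eq n.+1 (leqW Nn); rewrite !big_ord_recr/= (S_eq n Nn) => /addrI.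
    by apply: powR_injective; rewrite ?nnegrE ?mdist_ge0// (lt_le_trans ltr01).
  move: xmin => [Dx fx]; split; first exact: D_equiv xx'.
  by move=> z Dz; rewrite /f -(frechet_functional_equiv hX p xx'); exact: fx.
have fn_equiv n a b : mu_equiv mu a b -> fn n a = fn n b.
  move=> /(mu_equivP hX) ab; rewrite /fn !frechet_functional_empirical//.
  by congr (EFin (_ * _)); apply: eq_bigr => i _; rewrite ab.
have class_equiv a b : argmin D f a -> argmin D f b -> mu_equiv mu a b.
  rewrite argminE => /(mu_equivP hX) xa /(mu_equivP hX) xb.
  by apply/(mu_equivP hX) => z sz; rewrite -xa// -xb.
have sep : \forall n \near \oo, forall a b, argmin D f a -> D b ->
    ~ argmin D f b -> (fn n a < fn n b)%E.
  apply: (finite_near hX) => a; apply: (finite_near hX) => b.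
  have [[Da fa]|na] := pselect (argmin D f a); last by apply: nearW.
  have [Db|nb] := pselect (D b); last by apply: nearW.
  have [bmin|bmin] := pselect (argmin D f b); first by apply: nearW.
  have /f_lt : (f a < f b)%E; last by apply: filterS.
  rewrite ltNge; apply/negP => ba; apply: bmin; split=> // z Dz.
  exact: le_trans ba (fa _ Dz).
(* [x0] empirically beats every point of [D] outside [argmin D f], so no such point is an empirical
   minimizer. Points of [argmin D f] are equivalent, hence tie with each other. *)
have [x0 x0min] := argmin_nonempty hX f D0.
apply: filterS2 DnD sep => n -> fn_lt; apply/seteqP; split=> [a [Da fna]|a amin].
  apply: contrapT => /(fn_lt _ _ x0min Da); rewrite ltNge => /negP; apply.
  by apply: fna; case: x0min.
split=> [|b Db]; first by case: amin.
have [bmin|bmin] := pselect (argmin D f b).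
  by rewrite (fn_equiv n _ _ (class_equiv _ _ amin bmin)).
exact/ltW/fn_lt.
Qed.

(** * Almost sure properties of the sample *)

Lemma ae_supp (R : realType) (X : pointedMetricType R)
    (hX : finite_set [set: X]) (mu : probability (borel X) R)
    (d : measure_display) (Omega : measurableType d) (P : probability Omega R)
    (Y : nat -> {RV P >-> borel X}) (hdist : identically_distributed mu Y) :
  {ae P, forall w, forall i, supp mu (Y i w)}.
Proof.
have aeF : Filter (almost_everywhere P) by exact: ae_filter_ringOfSetsType.
apply: ae_foralln => i.
have : \forall w \ae P, forall z : X, Y i w = z -> supp mu z.
  apply: (finite_near hX) => z.
  have [sz|nsz] := pselect (supp mu z); first exact: aeW.
  have mz : measurable [set z : borel X] by exact: finite_metric_measurable.
  exists (Y i @^-1` [set z]); split.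
  - by rewrite -[_ @^-1` _]setTI; exact: measurable_funP.
  - rewrite -[LHS]/(distribution P (Y i) [set z]) hdist//.
    apply/eqP; rewrite -measure_le0 leNgt; apply/negP => mz0.
    by apply: nsz; rewrite suppE.
  - by move=> w /= /not_implyP[].
by apply: filterS => w; apply.
Qed.

(** The one-sided limit theorem [ae_sum_lt0] takes the place of the second Borel-Cantelli lemma. *)
Lemma ae_infinitely_often (R : realType) (X : pointedMetricType R)
    (hX : finite_set [set: X]) (mu : probability (borel X) R)
    (d : measure_display) (Omega : measurableType d) (P : probability Omega R)
    (Y : nat -> {RV P >-> borel X})
    (hind : mutually_independent Y) (hdist : identically_distributed mu Y) :
  {ae P, forall w, forall z : X, supp mu z ->
    forall N, exists2 n, (N <= n)%N & Y n w = z}.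
Proof.
have aeF : Filter (almost_everywhere P) by exact: ae_filter_ringOfSetsType.
apply: (finite_near hX) => z.
have [sz|nsz] := pselect (supp mu z); last exact: aeW.
set c := fine (mu [set z]).
have c0 : 0 < c.
  move: sz; rewrite suppE//= => mz; rewrite fine_gt0// mz ltey_eq.
  by rewrite fin_num_measure//; exact: finite_metric_measurable.
(* [g] has mean [- c / 2], but its sums would grow at rate [c / 2] if [z] were
   not visited any more. *)
pose g (y : X) : R := c / 2 - (y == z)%:R.
have zT : z \in fset_set [set: X] by rewrite in_fset_set// in_setT.
have Eg : \sum_(y : fset_set [set: X]) fine (mu [set val y]) * g (val y) < 0.
  rewrite /g; under eq_bigr do rewrite mulrBr.
  rewrite sumrB -mulr_suml sum_atoms// mul1r (bigD1 [` zT]%fset)//= eqxx mulr1.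
  rewrite big1 ?addr0 -/c; first by lra.
  by move=> y; rewrite -val_eqE /= => /negbTE ->; rewrite mulr0.
apply: filterS (ae_sum_lt0 hX hind hdist Eg) => w [N0 _ Hw] _ N.
apply: contrapT => noz.
pose S n := \sum_(0 <= i < n) g (Y i w).
have Sk k : S (N + k)%N = S N + k%:R * (c / 2).
  elim: k => [|k IH]; first by rewrite addn0 mul0r addr0.
  have -> : S (N + k.+1)%N = S (N + k)%N + g (Y (N + k)%N w).
    by rewrite addnS /S big_nat_recr.
  rewrite IH /g.
  have /negbTE -> : Y (N + k)%N w != z.
    by apply/eqP => Yz; apply: noz; exists (N + k)%N => //; exact: leq_addr.
  by rewrite subr0 -addrA -[k.+1]addn1 natrD mulrDl mul1r.
(* [N0] brings [N + k] past the threshold of [Hw]; the truncation makes [k%:R * (c / 2)] outweigh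
   [S N]. *)
pose k := (N0 + Num.truncn (`|S N| / (c / 2))).+1.
have : S (N + k)%N < 0.
  rewrite /S big_mkord; apply: Hw => /=.
  by rewrite /k addnS -addSn addnA (leq_trans _ (leq_addr _ _))// leq_addl.
rewrite Sk ltNge => /negP; apply.
have : `|S N| <= k%:R * (c / 2).
  rewrite -ler_pdivrMr ?divr_gt0//; apply/ltW.
  have := truncnS_gt (`|S N| / (c / 2)) => /lt_le_trans; apply.
  by rewrite ler_nat /k ltnS leq_addl.
have := ler_norm (- S N); rewrite normrN; lra.
Qed.

Lemma ae_frechet_functional_lt (R : realType) (p : R) (X : pointedMetricType R)
    (hX : finite_set [set: X]) (mu : probability (borel X) R)
    (d : measure_display) (Omega : measurableType d) (P : probability Omega R)
    (Y : nat -> {RV P >-> borel X})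
    (hind : mutually_independent Y) (hdist : identically_distributed mu Y) :
  {ae P, forall w, forall x x',
    (frechet_functional p mu x < frechet_functional p mu x')%E ->
    \forall n \near \oo,
      (frechet_functional p (empirical_measure (Y ^~ w) n) x <
       frechet_functional p (empirical_measure (Y ^~ w) n) x')%E}.
Proof.
have aeF : Filter (almost_everywhere P) by exact: ae_filter_ringOfSetsType.
apply: (finite_near hX) => x; apply: (finite_near hX) => x'.
have [fxx'|] := ltP (frechet_functional p mu x) (frechet_functional p mu x');
  last by move=> _; exact: aeW.
pose g (y : X) := mdist x y `^ p - mdist x' y `^ p.
have Eg : \sum_(y : fset_set [set: X]) fine (mu [set val y]) * g (val y) < 0.
  move: fxx'; rewrite !frechet_functionalE// lte_fin -subr_lt0 -sumrB.
  by under eq_bigr do rewrite -mulrBr.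
apply: filterS (ae_sum_lt0 hX hind hdist Eg) => w Hw _.
(* At [n = 0] both empirical functionals vanish, hence the restriction to [0 < n]. *)
apply: filterS2 Hw (nbhs_infty_gt 0) => n; rewrite sumrB subr_lt0 => Hn n0.
rewrite !frechet_functional_empirical// lte_fin ltr_pM2l//.
by rewrite invr_gt0 ltr0n.
Qed.

Theorem theorem4p15 (R : realType) (p : R) (hp : 1 <= p)
    (X : pointedMetricType R) (hX : finite_set [set: X])
    (mu : probability (borel X) R)
    (d : measure_display) (Omega : measurableType d) (P : probability Omega R)
    (Y : nat -> {RV P >-> borel X})
    (hind : mutually_independent Y)
    (hdist : identically_distributed mu Y) :
  ({ae P, forall w,
     fell_cvg (fun n => frechet_mean p (empirical_measure (Y ^~ w) n))
              (frechet_mean p mu)}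
   <-> exists x : X, frechet_mean p mu = mu_class mu x)
  /\
  ({ae P, forall w,
     fell_cvg (fun n => restricted_frechet_mean p
                          (empirical_measure (Y ^~ w) n))
              (restricted_frechet_mean p mu)}
   <-> exists x : X, restricted_frechet_mean p mu = mu_class mu x).
Proof.
have P_gt0 : (0 < P [set: Omega])%E by rewrite probability_setT.
have aeF : ProperFilter (almost_everywhere P).
  exact: ae_properfilter_algebraOfSetsType P_gt0.
(* [Q0] does not depend on the outcome, so an almost sure equivalence suffices; properness of the
   filter supplies the outcome at which [Q0] is read off. *)
have ae_iff (Q : Omega -> Prop) (Q0 : Prop) :
    {ae P, forall w, Q w <-> Q0} -> {ae P, forall w, Q w} <-> Q0.
  move=> QQ0; split=> [/(filterI QQ0)/filter_ex[w [[+ _] Qw]]|q0]; first exact.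
  by apply: filterS QQ0 => w [_]; apply.
have ae_supp_Y := ae_supp hX hdist.
have ae_io := ae_infinitely_often hX hind hdist.
have ae_lt := ae_frechet_functional_lt p hX hind hdist.
split; apply: ae_iff; apply: filterS3 ae_supp_Y ae_io ae_lt => w supp_Y io lt.
  rewrite fell_cvgP//.
  apply: (argmin_eventually_class hp hX (D := setT) (Dn := fun=> setT)
    supp_Y io lt) => //; [exact: nearW|by exists (Y 0 w)].
rewrite fell_cvgP//.
apply: (argmin_eventually_class hp hX (D := supp mu)
  (Dn := fun n => supp (empirical_measure (Y ^~ w) n)) supp_Y io lt).
(* Once every atom has been visited, the empirical support is all of [supp mu]; it never exceeds
   it. *)
- have : \forall n \near \oo, forall z, supp mu z ->
      supp (empirical_measure (R := R) (Y ^~ w) n) z.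
    apply: (finite_near hX) => z.
    have [sz|nsz] := pselect (supp mu z); last exact: nearW.
    have [m _ Ymz] := io z sz 0.
    by exists m.+1 => // n /= mn _; rewrite supp_empirical//; exists m.
  apply: filterS => n sub; apply/seteqP; split=> z; last exact: sub.
  by rewrite supp_empirical// => -[i _ <-].
- by exists (Y 0 w).
(* A point equivalent to an atom [x] is [x]: test the distances at [x] itself. *)
- move=> x x' sx /(mu_equivP hX) /(_ x sx); rewrite mdistxx => /esym.
  by move=> /mdist_positivity ->.
Qed.
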